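(* For every $\theta\in\Theta$, the expectation $\mathbb{E}_\theta[q_n^\theta]$ of the posterior probability of $\theta$ with respect to $\mathbb{P}_\theta$ is (weakly) increasing in $n$, and, more generally, so is $\mathbb{E}_\theta[f(q_n^\theta)]$ for any convex (weakly) increasing function $f$.
   Context: Standard Bayesian setup: $\Theta$ is a finite parameter space with a prior $\pi$ satisfying $\pi(\theta)>0$ for all $\theta\in\Theta$. The data are a process of discrete observations $x_1,x_2,\ldots$ (taking values in a finite or countable set), whose joint distribution given $\theta$ is $\mathbb{P}_\theta$; no assumption is made on the dependence structure over $n$ (the observations need not be iid). $\mathbb{P}=\sum_{\theta\in\Theta}\pi(\theta)\mathbb{P}_\theta$ is the marginal probability. For $s_n=(x_1,\ldots,x_n)$ with $\mathbb{P}(s_n)>0$, the posterior of $\theta$ at time $n$ is $q_n^\theta=q_n^\theta(s_n)=\mathbb{P}(\theta\mid s_n)=\mathbb{P}_\theta(s_n)\pi(\theta)/\mathbb{P}(s_n)$. $\mathbb{E}_\theta$ is the expectation with respect to $\mathbb{P}_\theta$. *)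

(* Defs.v *)
From HB Require Import structures.
From mathcomp Require Import all_boot all_order all_algebra.
From mathcomp Require Import all_classical all_reals all_analysis.

Set Implicit Arguments.
Unset Strict Implicit.
Unset Printing Implicit Defensive.

Import Order.TTheory GRing.Theory Num.Theory.
Import numFieldNormedType.Exports.

Local Open Scope classical_set_scope.
Local Open Scope ring_scope.

Section Bayes.
Context {d : measure_display} {T : measurableType d} {R : realType}.
Context {Theta : finType} {X : Type}.

(* The process is indexed from 0: [x 0] is the first observation, and
   [sample x n w] is the data s_n = (x 0 w, ..., x n.-1 w). *)
Definition sample (x : nat -> T -> X) (n : nat) (w : T) : n.-tuple X :=
  [tuple x i w | i < n].

Definition sample_event (x : nat -> T -> X) (n : nat) (s : n.-tuple X) :
  set T := sample x n @^-1` [set s].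

Definition marginal (prior : Theta -> R) (P : Theta -> probability T R)
    (A : set T) : \bar R :=
  (\sum_(theta : Theta) (prior theta)%:E * P theta A)%E.

(* Division by 0 is 0, so this is 0 on the data of marginal probability 0, which are
   also null for each [P theta] with [0 < prior theta]. *)
Definition posterior (prior : Theta -> R) (P : Theta -> probability T R)
    (x : nat -> T -> X) (theta : Theta) (n : nat) (s : n.-tuple X) : R :=
  fine (P theta (sample_event x s)) * prior theta
  / fine (marginal prior P (sample_event x s)).

Definition posterior_rv (prior : Theta -> R) (P : Theta -> probability T R)
    (x : nat -> T -> X) (theta : Theta) (n : nat) (w : T) : R :=
  posterior prior P x theta (sample x n w).

End Bayes.

(* Main.v *)
Require Import Defs.
From HB Require Import structures.
From mathcomp Require Import all_boot all_order all_algebra.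
From mathcomp Require Import all_classical all_reals all_analysis.
From mathcomp Require Import measurable_realfun ring lra.

(** Fix [theta] and write [P] for its law, [p] for its prior probability, [M]
    for the marginal law and [q_n] for the posterior of [theta], so that
    [q_n = p P(F) / M(F)] on each fiber [F] of the first [n] observations.

    Under [P] the process [1 / q_n] is a supermartingale: the [P]-integral of
    [1 / q_m] is [M(F) / p] over a non-null fiber [F] of [m] observations and
    [0] over a null one, so over an event [A] decided by [m] observations it is
    at most [M(A) / p] ([integral_inv_bayes_le]).  When [A] is a fiber of only
    [n <= m] observations, on which [q_n] is a constant [q], this says that
    [1 - q / q_m] has a nonnegative [P]-integral over [A].

    On the other hand, if [0 < q < 1] and [c >= 0] is the slope of a supporting
    line of [f] at [q], then [f(t) - f(q) >= c (t - q) >= c q (1 - q / t)] for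
    [0 < t <= 1], because [(t - q) - q (1 - q / t) = (t - q)^2 / t]
    ([convex_inv_subgradient]).  Taking [t = q_m] and integrating over [A] shows
    that [f(q_m) - f(q_n)] has a nonnegative integral over every fiber of [n]
    observations, hence in total ([integral_bayes_le]).

    At [q = 1] the function [f] may jump and have no supporting line.  But then
    [p P] and [M] agree on [A], hence on all its measurable subsets, so that
    [q_m = 1] almost surely on [A] and [c = 0] works ([bayes_inv_subgradient]).

    The monotonicity of the expectation of the posterior itself is the case
    where [f] is the identity. *)

Import Order.TTheory GRing.Theory Num.Theory.
Import numFieldNormedType.Exports.

Local Open Scope classical_set_scope.
Local Open Scope ring_scope.

Set Implicit Arguments.
Unset Strict Implicit.
Unset Printing Implicit Defensive.

(** * Supporting lines of convex functions *)

Section convexity.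
Context {R : realType} (f : R -> R).
Hypothesis f_convex : convex_function (`[0, 1]%classic : set R) f.
Hypothesis f_nondecreasing : {in `[0, 1] &, {homo f : a b / a <= b}}.

Lemma convex_three_chords (a q b : R) : 0 <= a -> b <= 1 -> a < q -> q < b ->
  (b - a) * f q <= (b - q) * f a + (q - a) * f b.
Proof.
move=> a0 b1 aq qb.
have ba : 0 < b - a by lra.
have t0 : 0 <= (b - q) / (b - a) by apply: divr_ge0; lra.
have t1 : (b - q) / (b - a) <= 1 by rewrite ler_pdivrMr ?mul1r//; lra.
have aD : a \in (`[0, 1]%classic : set R).
  by rewrite inE/= in_itv/=; apply/andP; split; lra.
have bD : b \in (`[0, 1]%classic : set R).
  by rewrite inE/= in_itv/=; apply/andP; split; lra.
have := f_convex (Itv01 t0 t1) aD bD; rewrite !convRE /= /unstable.onem.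
have -> : conv (Itv01 t0 t1) (a : convex_lmodType R) b = q.
  rewrite [LHS](_ : _ = (b - q) / (b - a) * a + (1 - (b - q) / (b - a)) * b)//.
  by field; rewrite gt_eqF.
rewrite -(ler_pM2l ba); congr (_ <= _).
by field; rewrite gt_eqF.
Qed.

(** The slope [c] is the left derivative of [f] at [q], the supremum of the
    slopes of the chords that end there: it exists because [q] is interior, and
    it is nonnegative because the chord from [0] has nonnegative slope. *)
Lemma convex_subgradient (q : R) : 0 < q -> q < 1 ->
  exists2 c, 0 <= c & forall t, 0 <= t -> t <= 1 -> c * (t - q) <= f t - f q.
Proof.
move=> q0 q1.
pose slopes := [set (f q - f a) / (q - a) | a in [set a | 0 <= a < q]].
have slope_le a b : 0 <= a -> a < q -> q < b -> b <= 1 ->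
    (f q - f a) / (q - a) <= (f b - f q) / (b - q).
  move=> a0 aq qb b1; have := convex_three_chords a0 b1 aq qb.
  by rewrite ler_pdivrMr ?ler_pdivlMr 1?mulrAC ?ler_pdivlMr; nra.
have slopes_ub b : q < b -> b <= 1 -> ubound slopes ((f b - f q) / (b - q)).
  by move=> qb b1 _ [a /andP[a0 aq] <-]; exact: slope_le.
have has_ub_slopes : has_ubound slopes.
  by exists ((f 1 - f q) / (1 - q)); exact: slopes_ub.
have slopes0 : slopes ((f q - f 0) / (q - 0)).
  by exists 0 => //=; rewrite lexx.
exists (sup slopes).
  apply: le_trans (ub_le_sup has_ub_slopes slopes0).
  rewrite divr_ge0 ?subr_ge0 ?(ltW q0)// f_nondecreasing ?(ltW q0)//.
    by rewrite in_itv/= lexx ler01.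
  by rewrite in_itv/= !ltW.
move=> t t0 t1; have [tq|qt|->] := ltgtP t q; last by rewrite !subrr mulr0.
- have : (f q - f t) / (q - t) <= sup slopes.
    by apply: (ub_le_sup has_ub_slopes); exists t => //=; rewrite t0 tq.
  by rewrite ler_pdivrMr ?subr_gt0//; lra.
- rewrite -ler_pdivlMr ?subr_gt0//; apply: ge_sup; last exact: slopes_ub.
  by eexists; exact: slopes0.
Qed.

(** A supporting line of [f] at [q] is lowered to a minorant that is affine in
    [1 / t], the variable whose integral is under control.  If the line has
    slope [s], it is lowered by [s (t - q)^2 / t] and [c] is [s q]. *)
Lemma convex_inv_subgradient (q : R) : 0 <= q -> q < 1 ->
  exists2 c, 0 <= c &
    forall t, 0 < t -> t <= 1 -> c * (1 - q * t^-1) <= f t - f q.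
Proof.
rewrite le_eqVlt => /orP[/eqP <- _|q0 q1].
  (* at q = 0 the minorant is constant and monotonicity is enough *)
  exists 0 => // t t0 t1; rewrite mul0r subr_ge0.
  by apply: f_nondecreasing; rewrite ?in_itv/= ?lexx ?ler01 ?(ltW t0) ?t1.
have [c c0 hc] := convex_subgradient q0 q1.
exists (c * q) => [|t t0 t1]; first by rewrite mulr_ge0 // ltW.
apply: le_trans (hc t (ltW t0) t1); rewrite -mulrA ler_wpM2l// -subr_ge0.
rewrite (_ : _ - _ = (t - q) ^+ 2 / t).
  by rewrite divr_ge0 ?sqr_ge0// ltW.
by field; rewrite gt_eqF.
Qed.

End convexity.

(** * Statistics with countably many values *)

Section discrete_statistic.
Context {R : realType} {d : measure_display} {T : measurableType d}.
Context {K : countType} (u : T -> K).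
Hypothesis u_discrete : forall k, measurable (u @^-1` [set k]).

Lemma measurable_preimage_discrete (A : set K) : measurable (u @^-1` A).
Proof.
rewrite (_ : u @^-1` A =
    \bigcup_k (if k \in A then u @^-1` [set k] else set0)); last first.
  apply/seteqP; split => [w Auw|w [k _]].
    by exists (u w) => //; rewrite mem_set.
  by case: ifPn => [/set_mem Ak /= ->|].
apply: countable_bigcupT_measurable; first exact: countableP.
by move=> k; case: ifP.
Qed.

Lemma measurable_fun_discrete d' (T' : measurableType d') (h : K -> T') :
  measurable_fun setT (h \o u).
Proof.
move=> _ B mB; rewrite setTI comp_preimage.
exact: measurable_preimage_discrete.
Qed.

(** Enumerating the fibers of [u] by natural numbers makes countable additivity
    applicable; the fiber is empty for a [j] that is not the code of a value. *)
Definition nth_fiber (j : nat) : set T := u @^-1` [set k | pickle k = j].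

Lemma measurable_nth_fiber j : measurable (nth_fiber j).
Proof. exact: measurable_preimage_discrete. Qed.

Lemma trivIset_nth_fiber : trivIset setT nth_fiber.
Proof. by move=> i j _ _ [w []]; rewrite /nth_fiber/= => -> ->. Qed.

Lemma bigcup_nth_fiber (A : set T) : \bigcup_j (A `&` nth_fiber j) = A.
Proof.
apply/seteqP; split => [w [j _] []//|w Aw].
by exists (pickle (u w)).
Qed.

Lemma nth_fiberE w : nth_fiber (pickle (u w)) = u @^-1` [set u w].
Proof.
apply/seteqP; split => v; rewrite /nth_fiber/=; first exact: (pcan_inj pickleK).
by move=> ->.
Qed.

Lemma measure_fibers (mu : {measure set T -> \bar R}) (A : set T) :
  measurable A -> (mu A = \sum_(j <oo) mu (A `&` nth_fiber j))%E.
Proof.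
move=> mA; rewrite -{1}(bigcup_nth_fiber A) measure_semi_bigcup//.
- by move=> j; apply: measurableI => //; exact: measurable_nth_fiber.
- exact: trivIset_setIl trivIset_nth_fiber.
- by rewrite bigcup_nth_fiber.
Qed.

(** There are only countably many fibers, so the null ones have a null union. *)
Lemma measure_null_fibers (mu : {measure set T -> \bar R}) :
  mu (u @^-1` [set k | mu (u @^-1` [set k]) = 0]) = 0.
Proof.
rewrite measure_fibers; last exact: measurable_preimage_discrete.
apply: eseries0 => j _ _.
have [->|/set0P[w [/= w0 wj]]] :=
  eqVneq (u @^-1` [set k | mu (u @^-1` [set k]) = 0] `&` nth_fiber j) set0.
  exact: measure0.
apply/eqP; rewrite -measure_le0 -{2}w0 le_measure//.
- rewrite inE; apply: measurableI; last exact: measurable_nth_fiber.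
  exact: measurable_preimage_discrete.
- exact/mem_set.
- by rewrite -nth_fiberE wj; exact: subIsetr.
Qed.

Lemma integral_fibers_ge0 (mu : {measure set T -> \bar R}) (h : T -> R) :
  mu.-integrable setT (EFin \o h) ->
  (forall k, 0 <= \int[mu]_(w in u @^-1` [set k]) (h w)%:E)%E ->
  (0 <= \int[mu]_w (h w)%:E)%E.
Proof.
move=> ih h0; rewrite -(bigcup_nth_fiber setT).
under eq_bigcupr do rewrite setTI.
rewrite integral_bigcup//.
- apply: nneseries_ge0 => j _ _.
  have [->|/set0P[w wj]] := eqVneq (nth_fiber j) set0.
    by rewrite integral_set0.
  by rewrite -wj nth_fiberE.
- exact: trivIset_nth_fiber.
- exact: measurable_nth_fiber.
- apply: integrableS ih => //; apply: bigcup_measurable => j _.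
  exact: measurable_nth_fiber.
Qed.

End discrete_statistic.

(** * The posterior of a component of a mixture *)

Section dominated_posterior.
Context {R : realType} {d : measure_display} {T : measurableType d}.
Variables (P M : {measure set T -> \bar R}) (p : R).
Hypothesis p_gt0 : 0 < p.
Hypotheses (P_fin : fin_num_fun P) (M_fin : fin_num_fun M).
Hypothesis P_dominated : forall A, measurable A -> (p%:E * P A <= M A)%E.

Let fine_dominated A : measurable A -> fine (P A) * p <= fine (M A).
Proof.
by move=> mA; rewrite mulrC -lee_fin EFinM !fineK ?P_fin ?M_fin// P_dominated.
Qed.

Let fine_measureD (mu : {measure set T -> \bar R}) A B : fin_num_fun mu ->
  measurable A -> measurable B -> B `<=` A ->
  fine (mu A) = fine (mu B) + fine (mu (A `\` B)).
Proof.
move=> mufin mA mB BA; have mAB := measurableD mA mB.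
rewrite -fineD ?mufin// -measureU//; last by rewrite setDIK.
by rewrite setDUK.
Qed.

(** The posterior probability of a hypothesis with prior [p] and law [P], when
    the marginal law is [M] and the observation is [u = k].  The marginal enters
    only through [p P <= M], which a mixture satisfies for each component. *)
Definition bayes {K : Type} (u : T -> K) (k : K) : R :=
  fine (P (u @^-1` [set k])) * p / fine (M (u @^-1` [set k])).

Section bayes_fiber.
Context {K : countType} (u : T -> K).
Hypothesis u_discrete : forall k, measurable (u @^-1` [set k]).

Lemma bayes_ge0 k : 0 <= bayes u k.
Proof.
by rewrite /bayes !mulr_ge0 ?invr_ge0 ?fine_ge0 ?measure_ge0 // ltW.
Qed.

Lemma bayes_le1 k : bayes u k <= 1.
Proof.
have [M0|M0] := eqVneq (fine (M (u @^-1` [set k]))) 0.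
  by rewrite /bayes M0 invr0 mulr0 ler01.
rewrite ler_pdivrMr ?mul1r; first exact: fine_dominated.
by rewrite lt_neqAle eq_sym M0 fine_ge0.
Qed.

(** Bayes' formula without a division: where [M] vanishes, so does [P] by
    domination, and both sides are [0]. *)
Lemma bayes_mul k :
  bayes u k * fine (M (u @^-1` [set k])) = fine (P (u @^-1` [set k])) * p.
Proof.
have [M0|M0] := eqVneq (fine (M (u @^-1` [set k]))) 0; last by rewrite divfK.
rewrite M0 mulr0; apply/esym/eqP; rewrite eq_le -{1}M0 fine_dominated//=.
by rewrite mulr_ge0 ?fine_ge0// ltW.
Qed.

Lemma bayes_gt0 k : P (u @^-1` [set k]) != 0 -> 0 < bayes u k.
Proof.
move=> P0; have rP0 : 0 < fine (P (u @^-1` [set k])) * p.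
  rewrite mulr_gt0// fine_gt0// lt_neqAle eq_sym P0 measure_ge0/=.
  by rewrite ltey_eq P_fin.
by rewrite divr_gt0// (lt_le_trans rP0)// fine_dominated.
Qed.

Lemma bayes_eq1 k :
  fine (P (u @^-1` [set k])) * p = fine (M (u @^-1` [set k])) ->
  P (u @^-1` [set k]) != 0 -> bayes u k = 1.
Proof.
move=> eqPM /bayes_gt0; rewrite /bayes eqPM => gt0.
by rewrite divff//; apply: contraTneq gt0 => ->; rewrite mul0r ltxx.
Qed.

(** Over a fiber [F] with [P F > 0] the integral is exactly [M F / p], over a
    null fiber it is [0]; the inequality is strict when [M] charges [P]-null
    fibers in [A].  For events decided by a coarser statistic, this is the
    supermartingale property of the inverse posterior. *)
Lemma integral_inv_bayes_le (A : set K) :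
  (\int[P]_(w in u @^-1` A) ((bayes u (u w))^-1)%:E
    <= (p^-1)%:E * M (u @^-1` A))%E.
Proof.
have mA := measurable_preimage_discrete u_discrete A.
have mF j : measurable (u @^-1` A `&` nth_fiber u j).
  by apply: measurableI => //; exact: measurable_nth_fiber.
rewrite (measure_fibers u_discrete M mA) -nneseriesZl//.
rewrite -{1}(bigcup_nth_fiber u (u @^-1` A)) ge0_integral_bigcup//.
- apply: lee_nneseries => [j _ _|j _].
    by apply: integral_ge0 => w _; rewrite lee_fin invr_ge0 bayes_ge0.
  have [->|/set0P[w [/= Aw wj]]] := eqVneq (u @^-1` A `&` nth_fiber u j) set0.
    by rewrite integral_set0 measure0 mule0.
  rewrite setIidr -wj nth_fiberE; last by move=> v /= ->.
  rewrite (eq_integral (cst ((bayes u (u w))^-1)%:E)); last first.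
    by move=> v /set_mem /= ->.
  rewrite integral_cst// -(fineK (P_fin (u_discrete _))).
  rewrite -(fineK (M_fin (u_discrete _))) -!EFinM lee_fin /bayes.
  rewrite !invfM invrK.
  have [->|P0] := eqVneq (fine (P (u @^-1` [set u w]))) 0.
    by rewrite mulr0 mulr_ge0 ?fine_ge0 ?invr_ge0 ?(ltW p_gt0).
  rewrite [leLHS](_ : _ = p^-1 * fine (M (u @^-1` [set u w])))//.
  by field; rewrite P0 gt_eqF.
- apply: measurable_funTS.
  exact: (measurable_fun_discrete u_discrete (fun k => ((bayes u k)^-1)%:E)).
- by move=> w _; rewrite lee_fin invr_ge0 bayes_ge0.
- by apply: trivIset_setIl; exact: trivIset_nth_fiber.
Qed.

End bayes_fiber.

Section refinement.
Context {K L : countType} (u : T -> K) (v : T -> L) (g : L -> K).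
Hypothesis u_discrete : forall k, measurable (u @^-1` [set k]).
Hypothesis v_discrete : forall l, measurable (v @^-1` [set l]).
Hypothesis uE : forall w, u w = g (v w).
Variable f : R -> R.
Hypothesis f_convex : convex_function (`[0, 1]%classic : set R) f.
Hypothesis f_nondecreasing : {in `[0, 1] &, {homo f : a b / a <= b}}.

(** If the coarse posterior is [1] on the fiber [u = k], then [M - p P] is a
    nonnegative measure of mass [0] there, so the finer posterior stays at [1]
    on non-null fibers and [c = 0] works, although [f] may have no supporting
    line at [1]. *)
Lemma bayes_inv_subgradient k : exists2 c, 0 <= c &
  forall w, u w = k -> P (v @^-1` [set v w]) != 0 ->
    c * (1 - bayes u k * (bayes v (v w))^-1)
      <= f (bayes v (v w)) - f (bayes u k).
Proof.
have := bayes_le1 u_discrete k.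
rewrite le_eqVlt => /orP[/eqP q1|q1]; last first.
  have [c c0 hc] :=
    convex_inv_subgradient f_convex f_nondecreasing (bayes_ge0 u k) q1.
  exists c => // w _ Pw; apply: hc; last exact: bayes_le1.
  exact: bayes_gt0.
exists 0 => // w uw Pw; rewrite mul0r q1 bayes_eq1 ?subrr//.
have vu : v @^-1` [set v w] `<=` u @^-1` [set k].
  by move=> w' /= vw; rewrite uE vw -uE.
have eq_k := bayes_mul u_discrete k; rewrite q1 mul1r in eq_k.
apply/eqP; rewrite eq_le fine_dominated//=.
have := fine_dominated (measurableD (u_discrete k) (v_discrete (v w))).
have := fine_measureD M_fin (u_discrete k) (v_discrete (v w)) vu.
have := fine_measureD P_fin (u_discrete k) (v_discrete (v w)) vu.
by move=> eP eM; rewrite eP eM in eq_k; lra.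
Qed.

Lemma integrable_bayes (K' : countType) (u' : T -> K') :
  (forall k, measurable (u' @^-1` [set k])) ->
  P.-integrable setT (EFin \o (fun w => f (bayes u' (u' w)))).
Proof.
move=> mu'; apply: measurable_bounded_integrable => //.
- by exact: fin_num_fun_lty.
- exact: (measurable_fun_discrete mu' (fun k => f (bayes u' k))).
- exists (Num.max `|f 0| `|f 1|); split; first exact: num_real.
  move=> x xmax w _ /=; apply: le_trans (ltW xmax).
  have q0 := bayes_ge0 u' (u' w); have q1 := bayes_le1 mu' (u' w).
  rewrite ler_norml; apply/andP; split.
    apply: (@le_trans _ _ (f 0)).
      by rewrite lerNl le_max -normrN ler_norm.
    by apply: f_nondecreasing; rewrite ?in_itv/= ?lexx ?ler01 ?q0 ?q1.
  apply: (@le_trans _ _ (f 1)); last by rewrite le_max ler_norm orbT.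
  by apply: f_nondecreasing; rewrite ?in_itv/= ?lexx ?ler01 ?q0 ?q1.
Qed.

(** Off the null fibers of [v], the integrand is at least [c (1 - q / q_v)],
    where [q] is the constant value of the coarse posterior and [q_v] is the
    fine one; the integral of this is at least
    [c (P (u = k) - q M (u = k) / p)], which is [0] by Bayes' formula. *)
Lemma integral_bayes_fiber_le k :
  (0 <= \int[P]_(w in u @^-1` [set k])
          (f (bayes v (v w)) - f (bayes u (u w)))%:E)%E.
Proof.
have [c c0 hc] := bayes_inv_subgradient k.
pose N := [set l | P (v @^-1` [set l]) = 0].
have mN : measurable (v @^-1` N) by exact: measurable_preimage_discrete.
have PN : P (v @^-1` N) = 0 by exact: measure_null_fibers.
pose A := [set l | g l = k].
have uk : u @^-1` [set k] = v @^-1` A.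
  by apply/seteqP; split => w /=; rewrite uE.
pose B := A `\` N.
have mB : measurable (v @^-1` B) by exact: measurable_preimage_discrete.
have mk := u_discrete k.
have fint : P.-integrable setT
    (EFin \o (fun w => f (bayes v (v w)) - f (bayes u (u w)))).
  have := integrableB measurableT
    (integrable_bayes v_discrete) (integrable_bayes u_discrete).
  by apply: eq_integrable.
have inv_ge0 w : (0 <= ((bayes v (v w))^-1)%:E)%E.
  by rewrite lee_fin invr_ge0 bayes_ge0.
have inv_meas : measurable_fun (v @^-1` B) (fun w => ((bayes v (v w))^-1)%:E).
  apply: measurable_funTS.
  exact: (measurable_fun_discrete v_discrete (fun l => ((bayes v l)^-1)%:E)).
have inv_le : (\int[P]_(w in v @^-1` B) ((bayes v (v w))^-1)%:E
               <= (p^-1)%:E * M (u @^-1` [set k]))%E.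
  apply: le_trans (integral_inv_bayes_le v_discrete B) _.
  rewrite lee_wpmul2l ?lee_fin ?invr_ge0 ?(ltW p_gt0)// uk.
  apply: le_measure; [exact/mem_set|by rewrite -uk; exact/mem_set|by move=> w []].
have inv_int : P.-integrable (v @^-1` B) (fun w => ((bayes v (v w))^-1)%:E).
  apply/integrableP; split => //.
  under eq_integral do rewrite gee0_abs//.
  apply: le_lt_trans inv_le _.
  by rewrite -(fineK (M_fin mk)) -EFinM ltry.
rewrite (@negligible_integral _ _ _ _ _ (v @^-1` N))//; last first.
  exact: integrableS fint.
have -> : u @^-1` [set k] `\` v @^-1` N = v @^-1` B by rewrite uk.
have cst_int : P.-integrable (v @^-1` B) (EFin \o cst c).
  apply: measurable_bounded_integrable => //.
    by rewrite -ge0_fin_numE// P_fin.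
  by exists c; split; [exact: num_real|move=> x cx w _ /=; rewrite ger0_norm// ltW].
have lin_int : P.-integrable (v @^-1` B)
    (fun w => (c%:E - (c * bayes u k)%:E * ((bayes v (v w))^-1)%:E)%E).
  apply: integrableB => //; exact: integrableZl.
apply: (@le_trans _ _ (\int[P]_(w in v @^-1` B)
    (c%:E - (c * bayes u k)%:E * ((bayes v (v w))^-1)%:E))%E); last first.
  apply: le_integral => //; first exact: integrableS fint.
  move=> w /set_mem[/= gk Nw]; rewrite lee_fin.
  have uw : u w = k by rewrite uE.
  rewrite uw; apply: le_trans (hc w uw _); last exact/eqP.
  by rewrite mulrBr mulr1 (mulrA c (bayes u k)).
rewrite integralB//; last exact: integrableZl.
rewrite integral_cst// integralZl// sube_ge0; last first.
  by rewrite fin_numM//; exact: integrable_fin_num.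
apply: (@le_trans _ _
    ((c * bayes u k)%:E * ((p^-1)%:E * M (u @^-1` [set k])))%E).
  by rewrite lee_wpmul2l// lee_fin mulr_ge0// bayes_ge0.
have -> : P (v @^-1` B) = P (u @^-1` [set k]).
  have mA : measurable (v @^-1` A) by rewrite -uk.
  rewrite uk (measureDI P mA mN) [X in (_ + X)%E](_ : _ = 0) ?adde0//.
  apply/eqP; rewrite -measure_le0 -PN le_measure//.
  - by rewrite inE; exact: measurableI.
  - exact/mem_set.
rewrite -(fineK (P_fin mk)) -(fineK (M_fin mk)) -!EFinM lee_fin.
rewrite [leLHS](_ : _ =
    c * (bayes u k * fine (M (u @^-1` [set k]))) / p); last by ring.
by rewrite bayes_mul// mulrA mulfK// gt_eqF.
Qed.

(** Refining the observation from [u] to [v] raises the [P]-integral of every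
    convex nondecreasing function of the posterior. *)
Lemma integral_bayes_le :
  (\int[P]_w (f (bayes u (u w)))%:E <= \int[P]_w (f (bayes v (v w)))%:E)%E.
Proof.
have iu := integrable_bayes u_discrete; have iv := integrable_bayes v_discrete.
rewrite -sube_ge0; last by rewrite (integrable_fin_num measurableT iu).
rewrite -integralB_EFin//.
apply: (integral_fibers_ge0 u_discrete) integral_bayes_fiber_le.
by have := integrableB measurableT iv iu; apply: eq_integrable.
Qed.

End refinement.
End dominated_posterior.

(** * The marginal law and the samples of the process *)

Section mixture.
Context {R : realType} {d : measure_display} {T : measurableType d}.
Context {Theta : finType} (prior : Theta -> R) (P : Theta -> probability T R).
Hypothesis prior_gt0 : forall theta, 0 < prior theta.

Lemma marginal_measure :
  exists M : {measure set T -> \bar R}, forall A, M A = marginal prior P A.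
Proof.
pose weight theta : {nonneg R} := NngNum (ltW (prior_gt0 theta)).
pose component i : {measure set T -> \bar R} :=
  if insub i is Some j then mscale (weight (enum_val (j : 'I_#|Theta|)))
                              (P (enum_val j))
  else mzero.
(* mzero only pads the sequence beyond the components that are summed *)
exists (msum component #|Theta|) => A; rewrite /msum /marginal/=.
rewrite (reindex (@enum_val Theta Theta)); last first.
  by exists enum_rank => ? _; [exact: enum_valK|exact: enum_rankK].
apply: eq_bigr => i _; rewrite /component.
by case: insubP => [j _ /val_inj ->|]; last by rewrite ltn_ord.
Qed.

Lemma marginal_ge (A : set T) theta :
  ((prior theta)%:E * P theta A <= marginal prior P A)%E.
Proof.
rewrite /marginal (bigD1 theta)//= leeDl// sume_ge0// => i _.
by rewrite mule_ge0// lee_fin ltW.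
Qed.

Lemma marginal_fin_num (A : set T) :
  measurable A -> marginal prior P A \is a fin_num.
Proof.
by move=> mA; apply/sum_fin_numP => theta _ _; rewrite fin_numM// fin_num_measure.
Qed.

End mixture.

Section samples.
Context {d : measure_display} {T : measurableType d}.
Context {X : Type} (x : nat -> T -> X).

Lemma sample_prefix n m (le_nm : (n <= m)%N) w :
  sample x n w = [tuple tnth (sample x m w) (widen_ord le_nm i) | i < n].
Proof. by apply: eq_from_tnth => i; rewrite !tnth_mktuple. Qed.

Lemma measurable_sample_event n (s : n.-tuple X) :
  (forall i (A : set X), measurable (x i @^-1` A)) ->
  measurable (sample x n @^-1` [set s]).
Proof.
move=> mx.
rewrite (_ : _ @^-1` _ = \bigcap_(i : 'I_n) (x i @^-1` [set tnth s i])).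
  by apply: fin_bigcap_measurable => //; exact: finite_finset.
apply/seteqP; split => w /=.
  by move=> <- i _ /=; rewrite tnth_mktuple.
by move=> h; apply: eq_from_tnth => i; rewrite tnth_mktuple; exact: h.
Qed.

End samples.

(** * Monotonicity of the expected posterior *)

Theorem corollary1
  (R : realType) (d : measure_display) (T : measurableType d)
  (Theta : finType) (prior : Theta -> R)
  (prior_gt0 : forall theta, 0 < prior theta)
  (prior_sum1 : \sum_(theta : Theta) prior theta = 1)
  (X : countType) (x : nat -> T -> X)
  (x_measurable : forall (i : nat) (A : set X), measurable (x i @^-1` A))
  (P : Theta -> probability T R) (theta : Theta) :
  nondecreasing_seq
    (fun n : nat => 'E_(P theta)[posterior_rv prior P x theta n])%E
  /\
  (forall f : R -> R,
     convex_function (`[0, 1]%classic : set R) f ->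
     {in `[0, 1] &, {homo f : a b / a <= b}} ->
     nondecreasing_seq
       (fun n : nat => 'E_(P theta)[f \o posterior_rv prior P x theta n])%E).
Proof.
have main (f : R -> R) : convex_function (`[0, 1]%classic : set R) f ->
    {in `[0, 1] &, {homo f : a b / a <= b}} ->
    nondecreasing_seq
      (fun n : nat => 'E_(P theta)[f \o posterior_rv prior P x theta n])%E.
  move=> f_convex f_homo n m le_nm; rewrite unlock /posterior_rv /=.
  have [M ME] := marginal_measure P prior_gt0.
  have x_discrete k (s : k.-tuple X) := measurable_sample_event s x_measurable.
  have P_fin : fin_num_fun (P theta).
    by move=> A mA; exact: fin_num_measure.
  have M_fin : fin_num_fun M.
    by move=> A mA; rewrite ME; exact: marginal_fin_num.
  have P_dominated A : measurable A ->
      ((prior theta)%:E * P theta A <= M A)%E.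
    by move=> _; rewrite ME; exact: marginal_ge.
  have := integral_bayes_le
    (g := fun s : m.-tuple X => [tuple tnth s (widen_ord le_nm i) | i < n])
    (prior_gt0 theta) P_fin M_fin P_dominated
    (x_discrete n) (x_discrete m) (sample_prefix x le_nm) f_convex f_homo.
  rewrite /bayes /posterior /sample_event.
  by under eq_integral do rewrite ME; under [X in (_ <= X)%E]eq_integral do rewrite ME.
split; last exact: main.
apply: (main id) => [t a b _ _|//].
exact: lexx.
Qed.
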